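(* Let $R$ be a commutative ring with identity, $X$ a set, and $(F_X,f_X)$ the free averaging $R$-algebra on $X$. Then $\ker(f_X)=[F_X,F_X]_{f_X}$.
   Context: The free averaging $R$-algebra on $X$ is $(F_X,f_X)$: let $\Theta(X)$ be the set of monomials of $R[X]$ with coefficient $1_R$ (including $1_R$), let $Y=\{y_\theta:\theta\in\Theta(X)\}$ be a set of symbols, pairwise distinct for distinct $\theta$ and disjoint from $X$; then $F_X=R[X\cup Y]$ is the polynomial algebra and $f_X$ is the $R$-linear map with $f_X(uv)=y_uv$ for $u\in\Theta(X)$, $v\in R[Y]$. It satisfies $f_X(xf_X(y))=f_X(x)f_X(y)$ for all $x,y\in F_X$. The bracket is $[x,y]_{f_X}=xf_X(y)-yf_X(x)$, and $[F_X,F_X]_{f_X}$ is the $R$-submodule of $F_X$ spanned by all $[x,y]_{f_X}$, $x,y\in F_X$. *)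

(* Defs.v *)
From HB Require Import structures.
From mathcomp Require Import all_boot all_algebra.
From mathcomp Require Import finmap.
From mathcomp.multinomials Require Import monalg.

Set Implicit Arguments.
Unset Strict Implicit.
Unset Printing Implicit Defensive.

Import GRing.Theory.
Local Open Scope fset_scope.
Local Open Scope ring_scope.

(* A monomial with coefficient 1 is identified with its finitely supported
   exponent function, so Theta(X) is {cmonom X}.  The variables of F_X are
   inl x for x in X, and inr u, standing for y_u, for u in Theta(X). *)
Notation avg_var X := (X + {cmonom X})%type.
Notation avg_monom X := {cmonom (avg_var X)}.
Notation free_avg_alg R X := {malg R[avg_monom X]}.

Section Monomials.
Context (X : choiceType).
Implicit Types (u : {cmonom X}) (m : avg_monom X).

Definition xexp u (i : avg_var X) : nat := if i is inl x then u x else 0%N.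
Definition yexp m (i : avg_var X) : nat := if i is inr _ then m i else 0%N.
Definition getx (i : avg_var X) : option X := if i is inl x then Some x else None.

(* The inclusion of Theta(X) in the monomials of F_X. *)
Definition xmonom u : avg_monom X :=
  [cmonom xexp u i | i in [fset (inl x : avg_var X) | x in finsupp u]]%M.

(* The two factors of a monomial of F_X, in R[X] and in R[Y]; the second is
   left in F_X. *)
Definition xpart m : {cmonom X} :=
  [cmonom m (inl x) | x in [fset x in pmap getx (finsupp m)]]%M.
Definition ypart m : avg_monom X := [cmonom yexp m i | i in finsupp m]%M.

Lemma xmonomE u i : xmonom u i = xexp u i.
Proof.
rewrite cmE fsfun_fun; case: ifPn => //; case: i => //= x.
apply: contraNeq; rewrite eq_sym cmE_neq0 => ux.
by apply/imfsetP; exists x.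
Qed.

Lemma xpartE m x : xpart m x = m (inl x).
Proof.
rewrite cmE fsfun_fun; case: ifPn => //; apply: contraNeq.
rewrite eq_sym cmE_neq0 => mx; rewrite inE /= mem_pmap.
by apply/mapP; exists (inl x).
Qed.

Lemma ypartE m i : ypart m i = yexp m i.
Proof.
rewrite cmE fsfun_fun; case: ifPn => //; rewrite -cmE_eq0 => /eqP mi.
by case: i mi.
Qed.

Lemma xpart_ypart m : m = mmul (xmonom (xpart m)) (ypart m).
Proof.
apply/eqP/cmP => i; rewrite cmM xmonomE ypartE.
by case: i => [x|u] /=; rewrite ?xpartE ?addn0.
Qed.
End Monomials.

Section FreeAveraging.
Context (R : comNzRingType) (X : choiceType).
Implicit Types (u : {cmonom X}) (m : avg_monom X) (p q v : free_avg_alg R X).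

(* f_X sends the monomial u w, with u in Theta(X) and w in R[Y], to y_u w. *)
Definition avg_mon m : avg_monom X := mmul (ucm (inr (xpart m))) (ypart m).
Definition free_avg p : free_avg_alg R X :=
  \sum_(m <- msupp p) << p@_m *g avg_mon m >>.

Lemma free_avgEw (d : {fset avg_monom X}) p : msupp p `<=` d ->
  free_avg p = \sum_(m <- d) << p@_m *g avg_mon m >>.
Proof.
move=> le_pd; rewrite /free_avg (big_fset_incl _ le_pd) //.
by move=> m _ /mcoeff_outdom ->; rewrite monalgU0.
Qed.

Lemma malgZU a b m : a *: << b *g m >> = << a * b *g m >> :> free_avg_alg R X.
Proof.
by rewrite -mul_malgC malgM_def fgmulUU mul1m.
Qed.

Lemma malgMUU a b m1 m2 :
  << a *g m1 >> * << b *g m2 >> = << a * b *g mmul m1 m2 >> :> free_avg_alg R X.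
Proof. exact: fgmulUU. Qed.

Lemma free_avg_is_linear : linear free_avg.
Proof.
move=> a p q; pose d := msupp (a *: p + q) `|` (msupp p `|` msupp q).
have le1 : msupp (a *: p + q) `<=` d by rewrite fsubsetUl.
have le2 : msupp p `<=` d by rewrite /d fsetUA fsetUAC fsubsetUr.
have le3 : msupp q `<=` d by rewrite /d fsetUA fsubsetUr.
rewrite (free_avgEw le1) (free_avgEw le2) (free_avgEw le3).
rewrite scaler_sumr -big_split /=; apply: eq_bigr => m _.
by rewrite malgZU -monalgUD -mcoeffZ -mcoeffD.
Qed.

HB.instance Definition _ := GRing.isLinear.Build R (free_avg_alg R X)
  (free_avg_alg R X) *:%R free_avg free_avg_is_linear.

Definition in_polyY v := forall m, m \in msupp v -> forall x, m (inl x) = 0%N.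

Lemma free_avgU a m : free_avg << a *g m >> = << a *g avg_mon m >>.
Proof. by rewrite (free_avgEw msuppU_le) big_seq_fset1 mcoeffUU. Qed.

(* With linearity, this characterizes f_X. *)
Lemma free_avgE u v : in_polyY v ->
  free_avg (<< xmonom u >> * v) = << ucm (inr u) >> * v.
Proof.
move=> Yv; transitivity
  (\sum_(m <- msupp v) free_avg (<< xmonom u >> * << v@_m *g m >>)).
  by rewrite -linear_sum -mulr_sumr -monalgE.
transitivity (\sum_(m <- msupp v) << ucm (inr u) >> * << v@_m *g m >>); last first.
  by rewrite -mulr_sumr -monalgE.
apply: eq_big_seq => m /Yv mx.
have mulU k : << k >> * << v@_m *g m >> = << v@_m *g mmul k m >> :> free_avg_alg R X.
  by rewrite malgMUU mul1r.
apply: etrans (congr1 free_avg (mulU _)) _; apply: etrans (esym (mulU _)).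
rewrite free_avgU /avg_mon.
suff [-> ->] : xpart (mmul (xmonom u) m) = u /\ ypart (mmul (xmonom u) m) = m.
  by [].
split; apply/eqP/cmP => i; first by rewrite xpartE cmM xmonomE mx addn0.
by rewrite ypartE; case: i => [x|w] /=; rewrite ?mx // cmM xmonomE.
Qed.

Lemma avg_monM m1 m2 :
  avg_mon (mmul m1 (avg_mon m2)) = mmul (avg_mon m1) (avg_mon m2).
Proof.
rewrite {1}/avg_mon.
have -> : xpart (mmul m1 (avg_mon m2)) = xpart m1.
  by apply/eqP/cmP => x; rewrite !xpartE !cmM cmU ypartE /= !addn0.
rewrite {2}/avg_mon -mulmA; congr (mmul _ _); apply/eqP/cmP => i.
by rewrite ypartE cmM ypartE; case: i => [x|u] //=; rewrite cmM ?cmU ?ypartE.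
Qed.

Lemma malg_additive_ext (f g : free_avg_alg R X -> free_avg_alg R X) :
    f 0 = 0 -> {morph f : p q / p + q} -> g 0 = 0 -> {morph g : p q / p + q} ->
  (forall a m, f << a *g m >> = g << a *g m >>) -> f =1 g.
Proof.
move=> f0 fD g0 gD fg p; transitivity (\sum_(m <- msupp p) f << p@_m *g m >>).
  by rewrite -(big_morph f fD f0) -monalgE.
transitivity (\sum_(m <- msupp p) g << p@_m *g m >>).
  by apply: eq_bigr => m _; apply: fg.
by rewrite -(big_morph g gD g0) -monalgE.
Qed.

Lemma free_avg_averaging p q :
  free_avg (p * free_avg q) = free_avg p * free_avg q.
Proof.
have f0 : free_avg 0 = 0 by apply: linear0.
have fD : {morph free_avg : p q / p + q} by apply: linearD.
move: p; apply: malg_additive_ext => [|x y||x y|a m].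
- by rewrite mul0r f0.
- by rewrite mulrDl fD.
- by rewrite f0 mul0r.
- by rewrite fD mulrDl.
rewrite free_avgU; move: q; apply: malg_additive_ext => [|x y||x y|b n].
- by rewrite f0 mulr0 f0.
- by rewrite fD mulrDr fD.
- by rewrite f0 mulr0.
- by rewrite fD mulrDr.
rewrite free_avgU; apply: etrans (congr1 free_avg (malgMUU _ _ _ _)) _.
by apply: etrans (esym (malgMUU _ _ _ _)); rewrite free_avgU avg_monM.
Qed.
End FreeAveraging.

Definition avg_bracket (A : nzRingType) (f : A -> A) (x y : A) : A :=
  x * f y - y * f x.

Definition in_span (R : nzRingType) (V : lmodType R) (S : V -> Prop) (v : V) :=
  exists (n : nat) (c : 'I_n -> R) (s : 'I_n -> V),
    (forall i, S (s i)) /\ v = \sum_(i < n) c i *: s i.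

Definition avg_commutator (R : nzRingType) (A : algType R) (f : A -> A) :
    A -> Prop :=
  in_span (fun z => exists x y : A, z = avg_bracket f x y).

(* Main.v *)
(** [f_X] sends basis monomials to basis monomials, [u w] to [y_u w] for [u] in
    [R[X]] and [w] in [R[Y]], so its kernel is spanned by the differences of two
    monomials with the same image.  If [y_u w = y_u' w'] with [u <> u'], then
    [w = y_u' t] and [w' = y_u t] for some [t], and the difference
    [u y_u' t - u' y_u t] is the bracket of [u] and [u' t]. *)

Require Import Defs.
From mathcomp Require Import all_boot all_algebra.
From mathcomp Require Import finmap.
From mathcomp.multinomials Require Import monalg.
Local Open Scope ring_scope.

Set Implicit Arguments.
Unset Strict Implicit.
Unset Printing Implicit Defensive.

Import GRing.Theory.

Lemma in_span_sum (R : nzRingType) (V : lmodType R) (S : V -> Prop)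
    (I : eqType) (s : seq I) (c : I -> R) (v : I -> V) :
  (forall i, i \in s -> S (v i)) -> in_span S (\sum_(i <- s) c i *: v i).
Proof.
(* The empty sum is treated apart because [nth] needs a default element, which a nonempty list
   supplies as its head. *)
case: s => [|i0 s] Sv.
  exists 0, (fun=> 0), (fun=> 0); split; first by case.
  by rewrite big_nil big_ord0.
exists (size (i0 :: s)), (fun k => c (nth i0 (i0 :: s) k)),
  (fun k => v (nth i0 (i0 :: s) k)).
split=> [k|]; first exact/Sv/mem_nth.
by rewrite (big_nth i0) big_mkord.
Qed.

Section Kernel.
Context (R : comNzRingType) (X : choiceType).
Implicit Types (m : avg_monom X) (p q : free_avg_alg R X).

(** The averaging identity turns the two terms into [f(p) f(q)] and [f(q) f(p)], which agree by
    commutativity. *)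
Lemma free_avg_bracket p q : free_avg (avg_bracket (@free_avg R X) p q) = 0.
Proof.
transitivity (free_avg (p * free_avg q) - free_avg (q * free_avg p)).
  exact: linearB.
apply/eqP; rewrite subr_eq0; apply/eqP.
apply: etrans (free_avg_averaging p q) _.
by apply: etrans (esym (free_avg_averaging q p)); apply: mulrC.
Qed.

Lemma avg_monE m i : avg_mon m i = ((inr (xpart m) == i) + yexp m i)%N.
Proof. by rewrite /avg_mon cmM cmU ypartE. Qed.

(** Once [u] is known, the factor [y_u] cancels from the image [y_u w] and leaves [w]. *)
Lemma avg_mon_xpart_inj m1 m2 :
  avg_mon m1 = avg_mon m2 -> xpart m1 = xpart m2 -> m1 = m2.
Proof.
move=> eq_avg eq_x; rewrite (xpart_ypart m1) (xpart_ypart m2) eq_x.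
congr mmul; apply/eqP/cmP => i; rewrite !ypartE.
by move/(congr1 (fun m => m i)): eq_avg; rewrite !avg_monE eq_x => /addnI.
Qed.

Lemma avg_mon_eq_bracket m1 m2 : avg_mon m1 = avg_mon m2 ->
  exists p q, << m1 >> - << m2 >> = avg_bracket (@free_avg R X) p q.
Proof.
move=> eq_avg; have [eq_x|neq_x] := eqVneq (xpart m1) (xpart m2).
  exists 0, 0; rewrite (avg_mon_xpart_inj eq_avg eq_x).
  by rewrite /avg_bracket mul0r !subrr.
(* [divcm] subtracts exponents with truncation at 0; [le_t] below makes it a true quotient. *)
pose t := divcm (ypart m1) (ucm (inr (xpart m2))).
have eqY i : ((inr (xpart m1) == i) + yexp m1 i =
              (inr (xpart m2) == i) + yexp m2 i)%N.
  by have /(congr1 (fun m => m i)) := eq_avg; rewrite !avg_monE.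
have tE i : t i = (yexp m1 i - (inr (xpart m2) == i))%N.
  by rewrite divcmE ypartE ucmE.
have le_t i : ((inr (xpart m2) == i) <= yexp m1 i)%N.
  (* At the index of [y_u'], the left indicator in [eqY] vanishes because [u] and [u'] differ, so
     [w] has exponent at least 1 there. *)
  have := eqY i; case: (@eqP _ (inr (xpart m2) : avg_var X) i) => [<-|//].
  have -> : (inr (xpart m1) == inr (xpart m2) :> avg_var X) = false.
    by apply: contraNF neq_x => /eqP[->].
  by rewrite add0n => ->.
have ypart1 : ypart m1 = mmul (ucm (inr (xpart m2))) t.
  by apply/eqP/cmP => i; rewrite cmM cmU tE ypartE subnKC.
have ypart2 : ypart m2 = mmul (ucm (inr (xpart m1))) t.
  apply/eqP/cmP => i; rewrite cmM cmU tE ypartE.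
  by rewrite (addnBA _ (le_t i)) (eqY i) addKn.
have Yt : in_polyY (<< t >> : free_avg_alg R X).
  move=> m /(fsubsetP msuppU_le); rewrite inE => /eqP -> x.
  by rewrite tE sub0n.
(* Needed to compute [f_X(u)] by writing [u] as [u * 1], with [1] in [R[Y]]. *)
have Y1 : in_polyY (1 : free_avg_alg R X).
  by move=> m /(fsubsetP msuppU_le); rewrite inE => /eqP -> x; rewrite cm1.
have mulU m n : << m >> * << n >> = << mmul m n >> :> free_avg_alg R X.
  by rewrite malgMUU mul1r.
pose x1 : free_avg_alg R X := << xmonom (xpart m1) >>.
pose x2 : free_avg_alg R X := << xmonom (xpart m2) >>.
pose y1 : free_avg_alg R X := << ucm (inr (xpart m1)) >>.
pose y2 : free_avg_alg R X := << ucm (inr (xpart m2)) >>.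
pose w : free_avg_alg R X := << t >>.
have f1 : free_avg x1 = y1.
  have e1 : free_avg (x1 * 1) = y1 * 1 := free_avgE _ Y1.
  exact: etrans (congr1 _ (esym (mulr1 x1))) (etrans e1 (mulr1 y1)).
have f2 : free_avg (x2 * w) = y2 * w := free_avgE _ Yt.
have -> : << m1 >> = x1 * (y2 * w).
  apply/esym/(etrans (congr1 (fun z => x1 * z) (mulU _ _))).
  apply: etrans (mulU _ _) (congr1 (fun m => << m >>) _).
  exact: esym (etrans (xpart_ypart m1) (congr1 (mmul _) ypart1)).
have -> : << m2 >> = x2 * (y1 * w).
  apply/esym/(etrans (congr1 (fun z => x2 * z) (mulU _ _))).
  apply: etrans (mulU _ _) (congr1 (fun m => << m >>) _).
  exact: esym (etrans (xpart_ypart m2) (congr1 (mmul _) ypart2)).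
exists x1, (x2 * w).
have e1 : x1 * free_avg (x2 * w) = x1 * (y2 * w) := congr1 _ f2.
have e2 : x2 * w * free_avg x1 = x2 * (y1 * w).
  apply: etrans (congr1 _ f1) _; apply: etrans (esym (mulrA _ _ _)) _.
  exact: congr1 (mulrC w y1).
exact: esym (congr2 (fun a b => a - b) e1 e2).
Qed.

(** [mmap] extends [h] linearly from basis monomials, so a relation [free_avg p = 0] can be
    transported along any choice of [h]. *)
Lemma mmap_free_avg (h : avg_monom X -> free_avg_alg R X) p :
  mmap (@malgC _ R) h (free_avg p) = \sum_(m <- msupp p) p@_m *: h (avg_mon m).
Proof.
rewrite /free_avg raddf_sum; apply: eq_bigr => m _.
by apply: etrans (mmapU _ _) _; apply: mul_malgC.
Qed.

End Kernel.

Theorem proposition5p9 (R : comNzRingType) (X : choiceType)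
    (p : free_avg_alg R X) :
  free_avg p = 0 <-> avg_commutator (@free_avg R X) p.
Proof.
split=> [p0|[n [c [s [Ss ->]]]]]; last first.
  rewrite linear_sum big1 // => i _; rewrite linearZ /=.
  by have [x [y ->]] := Ss i; rewrite free_avg_bracket scaler0.
pose s : seq (avg_monom X) := msupp p.
(* The first monomial of the support with image [k]; the default [onecm] occurs only if there is
   none. *)
pose rep k := nth (onecm _) s (find (fun m => avg_mon m == k) s).
have repK m : m \in s -> avg_mon m = avg_mon (rep (avg_mon m)).
  move=> sm; apply/esym/eqP/(nth_find (onecm _) (a := fun n => avg_mon n == avg_mon m)).
  by apply/hasP; exists m.
(* Transporting [free_avg p = 0] along [rep] shows that subtracting the representatives leaves [p]
   unchanged. *)
have rep0 : \sum_(m <- s) p@_m *: (<< rep (avg_mon m) >> : free_avg_alg R X) = 0.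
  by rewrite -(mmap_free_avg (fun k => << rep k >>)) p0 raddf0.
suff -> : p = \sum_(m <- s) p@_m *: (<< m >> - << rep (avg_mon m) >>).
  by apply: in_span_sum => m /repK; apply: avg_mon_eq_bracket.
transitivity (\sum_(m <- s) (<< p@_m *g m >> - p@_m *: << rep (avg_mon m) >>)).
  by rewrite sumrB rep0 subr0; apply: monalgE.
apply: eq_bigr => m _.
have e : p@_m *: << m >> = << p@_m *g m >> :> free_avg_alg R X.
  exact: etrans (malgZU _ _ _) (congr1 (fun a => << a *g m >>) (mulr1 _)).
exact: etrans (congr1 (fun z => z - _) (esym e)) (esym (scalerBr _ _ _)).
Qed.
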